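(* Let $\mathcal{S}(132)$ denote the set of all permutations of all lengths $n\ge 0$ (including the empty permutation) that avoid the classical pattern $1\text{-}3\text{-}2$. For a permutation $\pi=\pi_1\cdots\pi_n$ define $e_1(\pi)=n$, $e_2(\pi)=\#\{i:\pi_i<\pi_{i+1}\}$ (the number of occurrences of the generalized pattern $12$, i.e. adjacent ascents), and for $k\ge 3$ let $e_k(\pi)$ be the number of occurrences of the generalized pattern $12\text{-}3\text{-}\cdots\text{-}k$, i.e. the number of index tuples $(i,j_3,\dots,j_k)$ with $i+1<j_3<j_4<\cdots<j_k$ and $\pi_i<\pi_{i+1}<\pi_{j_3}<\cdots<\pi_{j_k}$. For $n\ge 0$ put $P_n=\prod_{k=0}^{n} x_{k+2}^{\binom{n}{k}}$, where $x_1,x_2,\dots$ are indeterminates. Then $$\sum_{\pi\in\mathcal{S}(132)}\prod_{k\ge1}x_k^{e_k(\pi)}=\cfrac{1}{1-x_1+x_1P_0-\cfrac{x_1P_0}{1-x_1+x_1P_1-\cfrac{x_1P_1}{1-x_1+x_1P_2-\cfrac{x_1P_2}{\ddots}}}},$$ so that the $(n+1)$st numerator is $x_1\prod_{k=0}^n x_{k+2}^{\binom nk}$.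
   Context: Identity of formal power series in the indeterminates $x_1,x_2,\dots$; a permutation avoids $1\text{-}3\text{-}2$ if it has no indices $a<b<c$ with $\pi_a<\pi_c<\pi_b$. *)

(* Defs.v *)
From HB Require Import structures.
From mathcomp Require Import all_boot all_order all_algebra all_fingroup finmap.
From mathcomp Require Import boolp classical_sets functions cardinality fsbigop.
From mathcomp Require Import xfinmap monalg.

Set Implicit Arguments.
Unset Strict Implicit.
Unset Printing Implicit Defensive.

Import GRing.Theory.
Local Open Scope classical_set_scope.
Local Open Scope ring_scope.

(* Formal power series over R in the (possibly infinitely many) commuting     *)
(* indeterminates indexed by I: arbitrary functions on the finitely supported *)
(* exponent vectors {cmonom I}. A record is used instead of an alias of the   *)
(* function type, which already carries the pointwise ring structure.         *)
Record fps (I : choiceType) (R : comNzRingType) : Type :=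
  Fps { fcoef : {cmonom I} -> R }.

Section FpsRing.
Variables (I : choiceType) (R : comNzRingType).
Local Notation M := {cmonom I}.
Local Notation S := (fps I R).
Implicit Types (f g h : S) (m : M).

Lemma fpsP f g : (forall m, fcoef f m = fcoef g m) -> f = g.
Proof. by case: f g => [f] [g] /= /funext->. Qed.

HB.instance Definition _ := gen_eqMixin S.
HB.instance Definition _ := gen_choiceMixin S.

Definition fps0 : S := Fps (fun _ => 0).
Definition fpsN f : S := Fps (fun m => - fcoef f m).
Definition fpsD f g : S := Fps (fun m => fcoef f m + fcoef g m).

Fact fpsDA : associative fpsD.
Proof. by move=> f g h; apply: fpsP => m /=; rewrite addrA. Qed.
Fact fpsDC : commutative fpsD.
Proof. by move=> f g; apply: fpsP => m /=; rewrite addrC. Qed.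
Fact fps0D : left_id fps0 fpsD.
Proof. by move=> f; apply: fpsP => m /=; rewrite add0r. Qed.
Fact fpsND : left_inverse fps0 fpsN fpsD.
Proof. by move=> f; apply: fpsP => m /=; rewrite addNr. Qed.

HB.instance Definition _ := GRing.isZmodule.Build S fpsDA fpsDC fps0D fpsND.

Definition factors2 m : set (M * M) := [set p | mmul p.1 p.2 = m].

Lemma factors2_finite m : finite_set (factors2 m).
Proof.
pose T := {ffun finsupp m -> 'I_(mdeg m).+1}.
pose q (p : M * M) : T * T :=
  ([ffun i => inord (p.1 (val i))], [ffun i => inord (p.2 (val i))]).
have le_deg (a b : M) i : mmul a b = m -> (a i <= mdeg m)%N.
  move=> <-; rewrite mdegM; apply: (leq_trans _ (leq_addr _ _)).
  case: (boolP (i \in finsupp a)) => [ia|]; last by rewrite memNfinsupp => /eqP->.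
  by rewrite mdegE (big_fsetD1 i) //= leq_addr.
have aux (a b a' b' : M) : mmul a b = m -> mmul a' b' = m ->
    [ffun i : finsupp m => inord (a (val i))] = [ffun i => inord (a' (val i))]
      :> T -> a = a'.
  move=> ab a'b' eqa; apply/eqP/cmP => i.
  case: (boolP (i \in finsupp m)) => [im|].
    move/ffunP: eqa => /(_ [` im]%fset); rewrite !ffunE /=.
    move=> /(congr1 val) /=; rewrite !inordK // ltnS.
      exact: le_deg a'b'.
    exact: le_deg ab.
  rewrite memNfinsupp => /eqP mi.
  have : (mmul a b) i = 0%N by rewrite ab.
  have : (mmul a' b') i = 0%N by rewrite a'b'.
  by rewrite !cmM; case: (a i) (a' i) => [|?] [|?].
have qinj : {in factors2 m &, injective q}.
  move=> [a b] [a' b'] /set_mem/= ab /set_mem/= a'b' [eqa eqb].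
  by rewrite (aux a b a' b') // (aux b a b' a') // mulmC.
have := inj_card_eq qinj; rewrite card_eq_le => /andP[_ /card_le_finite].
by apply; exact: finite_finset.
Qed.

Definition fps1 : S := Fps (fun m => (m == mone)%:R).
Definition fpsM f g : S :=
  Fps (fun m => \sum_(p \in factors2 m) fcoef f p.1 * fcoef g p.2).

Let D m := fset_set (factors2 m).

Let inD m p : (p \in D m) = (mmul p.1 p.2 == m).
Proof.
rewrite in_fset_set; last exact: factors2_finite.
by apply/idP/eqP => [/set_mem|/mem_set].
Qed.

Let fcoefM f g m :
  fcoef (fpsM f g) m = \sum_(p <- D m) fcoef f p.1 * fcoef g p.2.
Proof. by rewrite /= fsbig_finite //; exact: factors2_finite. Qed.

Fact fpsMC : commutative fpsM.
Proof.
move=> f g; apply: fpsP => m; rewrite !fcoefM.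
rewrite [RHS](eq_bigr (fun p => fcoef f p.2 * fcoef g p.1)); last first.
  by move=> p _; rewrite mulrC.
rewrite -(big_map (fun p : M * M => (p.2, p.1)) xpredT
            (fun p => fcoef f p.1 * fcoef g p.2)).
apply/perm_big/uniq_perm; rewrite ?fset_uniq //.
  by rewrite map_inj_uniq ?fset_uniq // => -[? ?] [? ?] [-> ->].
move=> [a b]; apply/idP/mapP => [|[[c d] + [-> ->]]]; rewrite !inD /= => ab.
  by exists (b, a); rewrite // inD /= mulmC.
by rewrite mulmC.
Qed.

Fact fpsMA : associative fpsM.
Proof.
move=> f g h; apply: fpsP => m; rewrite !fcoefM.
under eq_bigr do rewrite fcoefM mulr_sumr.
under [RHS]eq_bigr do rewrite fcoefM mulr_suml.
pose F (t : M * M * M) := fcoef f t.1.1 * fcoef g t.1.2 * fcoef h t.2.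
rewrite -(big_allpairs_dep (h := fun p q : M * M => (q.1, q.2, p.2)) (F := F)).
under eq_bigr do under eq_bigr do rewrite mulrA.
rewrite -(big_allpairs_dep (h := fun p q : M * M => (p.1, q.1, q.2)) (F := F)).
apply/perm_big/uniq_perm.
- apply: allpairs_uniq_dep => [|p _|[p q] [p' q']]; rewrite ?fset_uniq //.
  move=> /allpairsPdep[[a b] [[c d] [_ + [-> ->]]]].
  move=> + /allpairsPdep[[a' b'] [[c' d'] [_ + [-> ->]]]].
  by rewrite !inD /= => /eqP<- /eqP<- [-> -> ->].
- apply: allpairs_uniq_dep => [|p _|[p q] [p' q']]; rewrite ?fset_uniq //.
  move=> /allpairsPdep[[a b] [[c d] [_ + [-> ->]]]].
  move=> + /allpairsPdep[[a' b'] [[c' d'] [_ + [-> ->]]]].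
  by rewrite !inD /= => /eqP<- /eqP<- [-> -> ->].
move=> [[a b] c]; apply/allpairsPdep/allpairsPdep.
  move=> [[a' d] [[b' c'] [+ + [-> -> ->]]]].
  rewrite !inD /= => /eqP<- /eqP<-.
  by exists (mmul a' b', c'), (a', b'); rewrite !inD /= mulmA.
move=> [[d c'] [[a' b'] [+ + [-> -> ->]]]].
rewrite !inD /= => /eqP<- /eqP<-.
by exists (a', mmul b' c'), (b', c'); rewrite !inD /= mulmA.
Qed.

Fact fps1M : left_id fps1 fpsM.
Proof.
move=> f; apply: fpsP => m; rewrite fcoefM (big_fsetD1 (mone, m)) /=; last first.
  by rewrite inD /= mul1m.
rewrite eqxx mul1r big1_fset ?addr0 // => -[a b].
rewrite in_fsetD1 inD /= => /andP[neq /eqP abm] _.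
case: (a =P mone) neq => [a1|_ _]; last by rewrite mul0r.
by rewrite -abm a1 mul1m eqxx.
Qed.

Fact fpsMDl : left_distributive fpsM fpsD.
Proof.
move=> f g h; apply: fpsP => m /=; rewrite !fsbig_finite /=;
  do ?exact: factors2_finite.
by rewrite -big_split; apply: eq_bigr => p _ /=; rewrite mulrDl.
Qed.

Fact fps1_neq0 : fps1 != 0 :> S.
Proof.
apply/eqP => /(congr1 (fun f => fcoef f mone)) /=.
by rewrite eqxx => /eqP; rewrite oner_eq0.
Qed.

HB.instance Definition _ := GRing.Zmodule_isComNzRing.Build S
  fpsMA fpsMC fps1M fpsMDl fps1_neq0.

Definition fps_unit : {pred S} := fun f => `[< exists g : S, g * f = 1 >].
Definition fps_inv f : S := xget f [set g : S | g * f = 1].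

Fact fps_mulVx : {in fps_unit, left_inverse 1 fps_inv *%R}.
Proof. by move=> f /asboolP[g gf]; rewrite /fps_inv; case: xgetP => // /(_ g). Qed.

Fact fps_unitPl f g : g * f = 1 -> fps_unit f.
Proof. by move=> gf; apply/asboolP; exists g. Qed.

Fact fps_inv_out : {in [predC fps_unit], fps_inv =1 id}.
Proof.
move=> f /asboolPn nf; rewrite /fps_inv; case: xgetP => // g _ gf.
by case: nf; exists g.
Qed.

HB.instance Definition _ := GRing.ComNzRing_hasMulInverse.Build S
  fps_mulVx fps_unitPl fps_inv_out.

Definition fpsX (i : I) : S := Fps (fun m => (m == ucm i)%:R).

(* Convergence in the product topology, coefficients being discrete.          *)
Definition fps_cvg (u : nat -> S) (f : S) : Prop :=
  forall m, exists N, forall n, (N <= n)%N -> fcoef (u n) m = fcoef f m.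

Definition fps_summable (J : choiceType) (A : set J) (F : J -> S) : Prop :=
  forall m, finite_set [set j | A j /\ fcoef (F j) m != 0].

(* Meaningful for summable families only: the finitely supported sum on the   *)
(* right is 0 by convention when its support is infinite.                     *)
Definition fps_sum (J : choiceType) (A : set J) (F : J -> S) : S :=
  Fps (fun m => \sum_(j \in A) fcoef (F j) m).

End FpsRing.

(* The n-term continued fraction                                              *)
(*   a j / (b j - a j.+1 / (b j.+1 - ... - a (j + n).-1 / b (j + n).-1))      *)
Fixpoint cfrac_from (R : unitRingType) (a b : nat -> R) (n j : nat) : R :=
  if n is n'.+1 then a j / (b j - cfrac_from a b n' j.+1) else 0.

(* f = a 0 / (b 0 - a 1 / (b 1 - a 2 / (b 2 - ...))), as the limit of the     *)
(* truncations. The first clause makes every division in them a genuine one.  *)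
Definition is_cfrac (I : choiceType) (R : comNzRingType)
    (a b : nat -> fps I R) (f : fps I R) : Prop :=
  (forall n j, b j - cfrac_from a b n j.+1 \is a GRing.unit) /\
  fps_cvg (fun n => cfrac_from a b n 0) f.

Definition avoids132 (n : nat) (p : 'S_n) : Prop :=
  ~ exists a b c : 'I_n, [/\ (a < b < c)%N & (p a < p c < p b)%N].

(* e_k; the value at k = 0 is never used. For k >= 3, the tuple js lists      *)
(* j_3, ..., j_k and i' is i + 1.                                             *)
Definition occ (n : nat) (p : 'S_n) (k : nat) : nat :=
  match k with
  | 0 => 0
  | 1 => n
  | 2 => #|[pred i : 'I_n |
            [exists i' : 'I_n, (i' == i.+1 :> nat) && (p i < p i')%N]]|
  | k'.+3 => #|[pred t : 'I_n * k'.+1.-tuple 'I_n |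
      let: (i, js) := t in
      [exists i' : 'I_n,
        [&& i' == i.+1 :> nat,
            sorted ltn (i.+1 :: [seq val j | j <- js]) &
            sorted ltn [:: val (p i), val (p i') & [seq val (p j) | j <- js]]]]]|
  end%N.

Lemma occ_gt (n : nat) (p : 'S_n) (k : nat) : (n < k)%N -> occ p k = 0%N.
Proof.
case: k => [|[|[|k]]] //= nk; first by case: n p nk.
  apply: eq_card0 => i; rewrite !inE; apply/existsP => -[j /andP[/eqP ji _]].
  by have := leq_trans (ltn_ord j) nk; rewrite ji ltnS.
apply: eq_card0 => -[i js]; rewrite !inE; apply/existsP => -[j /and3P[_ _]].
pose s := [:: val (p i), val (p j) & [seq val (p l) | l <- js]].
move=> srt; have {srt} us : uniq s.
  by apply: (@sorted_uniq _ ltn) => //; [exact: ltn_trans | exact: ltnn].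
have ss : {subset s <= iota 0 n}.
  move=> y; rewrite mem_iota add0n leq0n !inE /=.
  by case/or3P => [/eqP->|/eqP->|/mapP[l _ ->]]; exact: ltn_ord.
have := uniq_leq_size us ss.
by rewrite /= size_map size_tuple size_iota => /(leq_trans nk); rewrite ltnn.
Qed.

(* x_1, x_2, ... are the indeterminates indexed by 0, 1, ...; xvar 0 is never *)
(* used.                                                                      *)
Definition xvar (k : nat) : fps nat int := fpsX int k.-1.

Definition S132 : set {n : nat & 'S_n} := [set s | avoids132 (tagged s)].

(* The product over k >= 1 may stop at the length n, see occ_gt.              *)
Definition weight (s : {n : nat & 'S_n}) : fps nat int :=
  \prod_(1 <= k < (tag s).+1) xvar k ^+ occ (tagged s) k.

Definition Pmon (n : nat) : fps nat int :=
  \prod_(k < n.+1) xvar k.+2 ^+ 'C(n, k).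

(* Main.v *)
Require Import Defs.
From mathcomp Require Import all_boot all_order all_algebra all_fingroup finmap.
From mathcomp Require Import boolp classical_sets functions cardinality fsbigop.
From mathcomp Require Import xfinmap monalg zify ring.

Set Implicit Arguments.
Unset Strict Implicit.
Unset Printing Implicit Defensive.

Import GRing.Theory.

(** A nonempty 132-avoiding permutation is L n R with n its largest letter,
    L and R avoiding 132 and every letter of L above every letter of R.  An
    occurrence of 12-3-...-k in L n R lies in L, or lies in R, or is an
    occurrence of 12-3-...-(k-1) in L followed by n; for k = 2 the last kind is
    a single ascent when L is nonempty.  Hence passing from R to L replaces x_k
    by x_k x_(k+1) for k >= 2.  Let F_m be the generating function after m such
    replacements, which take x_2 to P_m.  Then
    F_m = 1 + x_1 (1 + P_m (F_(m+1) - 1)) F_m, that is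
    F_m (1 - x_1 + x_1 P_m - x_1 P_m F_(m+1)) = 1.  Iterating this relation
    gives the continued fraction, and it converges because each level
    contributes a factor x_1 to the error. *)

(** * Words avoiding 132 *)

Fixpoint av132 (s : seq nat) : bool :=
  if s is x :: s' then pairwise (fun y z => ~~ (x < z < y)) s' && av132 s'
  else true.

(* The number of increasing subsequences of length r with letters above x. *)
Fixpoint inc (r x : nat) (s : seq nat) : nat :=
  match r, s with
  | 0, _ => 1
  | _, [::] => 0
  | r'.+1, y :: s' => (if x < y then inc r' y s' else 0) + inc r x s'
  end.

(* The number of occurrences of 12-3-...-(r+2). *)
Fixpoint asc (r : nat) (s : seq nat) : nat :=
  if s is x :: s' then
    (if s' is y :: s'' then if x < y then inc r y s'' else 0 else 0) + asc r s'
  else 0.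

Lemma inc0 x s : inc 0 x s = 1.
Proof. by case: s. Qed.

Lemma inc_small r x s : all (geq x) s -> inc r.+1 x s = 0.
Proof. by elim: s => //= y s IH /andP[yx /IH ->]; rewrite ltnNge yx. Qed.

(** The letters of [R] lie below [x] and [n] exceeds everything, so a subsequence that leaves [L]
    does so only through [n], as its last letter. *)
Lemma inc_cat r x n L R : all (gtn n) (x :: L) -> all (gtn n) R ->
  allrel gtn (x :: L) R ->
  inc r x (L ++ n :: R) = inc r x L + (if r is r'.+1 then inc r' x L else 0).
Proof.
move=> + Rn; elim: L r x => [|y L IH] [|r] x /=; rewrite ?inc0 //.
  rewrite andbT => -> /allrelP xR; rewrite (@inc_small _ x R); last first.
    by apply/allP => z zR /=; apply: ltnW; apply: xR; rewrite ?inE.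
  case: r => [|r]; rewrite ?inc0 // inc_small //.
  by apply/allP => z /(allP Rn) /= /ltnW.
move=> /and3P[xn yn Ln]; rewrite !allrel_consl => /and3P[xR yR LR].
rewrite (IH r.+1) /= ?xn ?Ln ?allrel_consl ?xR //.
rewrite IH /= ?yn ?Ln ?allrel_consl ?yR //.
by case: ifP => _; case: r => [|r] //=; rewrite ?inc0; lia.
Qed.

(** No occurrence starts at [n], since a descent follows, and one that starts in [L] never enters
    [R]. Those that use [n] end there; for [r = 0] the only such one is the ascent from the last
    letter of [L]. *)
Lemma asc_cat r n L R : all (gtn n) L -> all (gtn n) R -> allrel gtn L R ->
  asc r (L ++ n :: R) =
  asc r L + (if r is r'.+1 then asc r' L else (L != [::]) : nat) + asc r R.
Proof.
move=> + Rn; have nR : asc r (n :: R) = asc r R.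
  case: R Rn => //= y R /andP[yn _]; by rewrite ltnNge (ltnW yn).
elim: L => [|x L IH]; first by rewrite cat0s nR; case: r {nR}.
rewrite /=; move=> /andP[xn Ln]; rewrite allrel_consl => /andP[xR LR].
rewrite IH //; case: L Ln LR IH => [|y L] /= Ln LR _.
  rewrite xn; case: r {nR} => [|r]; rewrite ?inc0 // inc_small //.
  by apply/allP => z /(allP Rn) /= /ltnW.
rewrite inc_cat //.
by case: ifP => _; case: r {nR} => [|r] //=; rewrite ?inc0; lia.
Qed.

Lemma inc_shift c r x s : inc r (c + x) (map (addn c) s) = inc r x s.
Proof.
elim: s r x => [|y s IH] [|r] x //=.
by rewrite ltn_add2l IH -[inc r.+1 x s]IH.
Qed.

Lemma asc_shift c r s : asc r (map (addn c) s) = asc r s.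
Proof.
by elim: s => //= x [|y s] //= ->; rewrite ltn_add2l inc_shift.
Qed.

Lemma inc_gt r x s : size s < r -> inc r x s = 0.
Proof.
elim: s r x => [|y s IH] [|r] x //=; rewrite ltnS => sr.
by rewrite !IH ?if_same //; exact: ltnW.
Qed.

Lemma asc_gt r s : size s <= r.+1 -> asc r s = 0.
Proof.
elim: s => //= x [|y s] //= IH; rewrite ltnS => sr.
by rewrite IH ?inc_gt ?if_same //; exact: ltnW.
Qed.

Lemma av132_shift c s : av132 (map (addn c) s) = av132 s.
Proof.
elim: s => //= x s ->; congr andb; rewrite pairwise_map.
by apply: eq_pairwise => y z /=; rewrite !ltn_add2l.
Qed.

(** With [n] as the 3, avoidance forces [L] above [R]; once [L] is above [R], no occurrence can use
    letters of both sides. *)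
Lemma av132_cat n L R : uniq (L ++ R) -> all (gtn n) L -> all (gtn n) R ->
  av132 (L ++ n :: R) = [&& av132 L, av132 R & allrel gtn L R].
Proof.
move=> + + Rn; have pR x : n <= x -> pairwise (fun y z => ~~ (x < z < y)) R.
  move=> nx; apply/(pairwiseP 0) => a b _ bR ab; apply/negP => /andP[xb _].
  by have := allP Rn _ (mem_nth 0 bR) => /=; lia.
elim: L => [|x L IH] /=; first by rewrite pR // andbT.
move=> /andP[xLR uLR] /andP[xn Ln]; rewrite IH // allrel_consl.
rewrite pairwise_cat allrel_consr /=.
have -> : all (fun y => ~~ (x < n < y)) L.
  by apply/allP => y /(allP Ln) /=; lia.
(* Here [n] plays the 3. Distinctness of the letters makes the comparison of [z] with [x] strict. *)
have E : all (fun z => ~~ (x < z < n)) R = all (gtn x) R.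
  apply: eq_in_all => z zR; have /= zn := allP Rn _ zR.
  have : z != x by apply: contraNneq xLR => <-; rewrite mem_cat zR orbT.
  by rewrite zn /=; lia.
rewrite E; case: (boolP (all (gtn x) R)) => [xR|_]; last by rewrite !andbF.
have -> : pairwise (fun y z => ~~ (x < z < y)) R.
  apply/(pairwiseP 0) => a b _ bR ab.
  by have := allP xR _ (mem_nth 0 bR) => /=; lia.
have -> : allrel (fun y z => ~~ (x < z < y)) L R.
  by apply/allrelP => y z _ /(allP xR) /=; lia.
by rewrite /= andbT -!andbA.
Qed.

(** Since [L] lies above [R], the sorted [R] followed by the sorted [L] is itself sorted, hence
    equals the whole interval, which is then cut at [size R]. *)
Lemma perm_iota_cat n L R : perm_eq (L ++ R) (iota 0 n) -> allrel gtn L R ->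
  perm_eq R (iota 0 (size R)) /\ perm_eq L (iota (size R) (size L)).
Proof.
move=> LRn /allrelP LR.
have sLR : size L + size R = n by rewrite -size_cat (perm_size LRn) size_iota.
have : sort leq R ++ sort leq L = iota 0 (size R) ++ iota (size R) (size L).
  rewrite -iotaD addnC sLR; apply: (sorted_eq leq_trans anti_leq).
  - rewrite (sorted_pairwise leq_trans) pairwise_cat.
    rewrite -!(sorted_pairwise leq_trans) !sort_sorted //; try exact: leq_total.
    rewrite !andbT; apply/allrelP => x y; rewrite !mem_sort => xR yL.
    by apply: ltnW; exact: LR.
  - exact: iota_sorted.
  - apply: perm_trans LRn; rewrite perm_catC.
    by apply: perm_cat; exact/permEl/perm_sort.
move/eqP; rewrite eqseq_cat ?size_sort ?size_iota // => /andP[/eqP ER /eqP EL].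
by rewrite -ER -EL; split; rewrite perm_sym; apply/permPl; exact: perm_sort.
Qed.

(** * Decomposition at the largest letter *)

Definition AV n := [seq s <- permutations (iota 0 n) | av132 s].

Lemma mem_AV n s : (s \in AV n) = av132 s && perm_eq s (iota 0 n).
Proof. by rewrite mem_filter mem_permutations. Qed.

Lemma size_AV n s : s \in AV n -> size s = n.
Proof. by rewrite mem_AV => /andP[_ /perm_size]; rewrite size_iota. Qed.

Lemma AV_lt n s : s \in AV n -> all (gtn n) s.
Proof.
rewrite mem_AV => /andP[_ sn]; rewrite (perm_all _ sn).
by apply/allP => x; rewrite mem_iota.
Qed.

(** Here [L] is standardized, with letters starting from 0; the shift by [size R] puts it above
    [R]. *)
Definition glue n (L R : seq nat) := map (addn (size R)) L ++ n :: R.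

Lemma glue_AV n k L R : k <= n -> L \in AV k -> R \in AV (n - k) ->
  [/\ all (gtn n) (map (addn (size R)) L), all (gtn n) R &
      allrel gtn (map (addn (size R)) L) R].
Proof.
move=> kn Lk Rk; have sR := size_AV Rk; rewrite sR; split.
- by apply/allP => _ /mapP[x /(allP (AV_lt Lk)) /= xk ->]; lia.
- by apply/allP => x /(allP (AV_lt Rk)) /=; lia.
- by apply/allrelP => _ y /mapP[x _ ->] /(allP (AV_lt Rk)) /=; lia.
Qed.

Lemma AV_rec n : perm_eq (AV n.+1)
  [seq glue n p.1 p.2 | k <- iota 0 n.+1,
     p <- [seq (L, R) | L <- AV k, R <- AV (n - k)]].
Proof.
have uAV k : uniq (AV k) by exact/filter_uniq/permutations_uniq.
apply: uniq_perm => //.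
- apply: allpairs_uniq_dep => [|k _|].
  + exact: iota_uniq.
  + by apply: allpairs_uniq => // -[? ?] [? ?].
  (* The position of [n] recovers [k], which gives injectivity of the gluing across different
     [k]. *)
  have glue_size k L R : k <= n -> L \in AV k -> R \in AV (n - k) ->
      index n (glue n L R) = k.
    move=> kn Lk Rk; have [Ln _ _] := glue_AV kn Lk Rk.
    rewrite index_cat ifN /= ?eqxx ?addn0 ?size_map ?(size_AV Lk) //.
    by apply/negP => /(allP Ln) /=; rewrite ltnn.
  move=> [k p] [k' p'].
  move=> /allpairsPdep[k1 [_ [+ /allpairsP[[L R] [Lk Rk ->]] [-> ->]]]].
  move=> + /allpairsPdep[k2 [_ [+ /allpairsP[[L' R'] [L'k R'k ->]] [-> ->]]]].
  rewrite !mem_iota /= !ltnS in Lk Rk L'k R'k * => k1n k2n E.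
  have k12 : k1 = k2.
    by rewrite -(glue_size k1 L R) // E (glue_size k2).
  subst k2; move/eqP: E; rewrite /glue eqseq_cat; last first.
    by rewrite !size_map (size_AV Lk) (size_AV L'k).
  rewrite (size_AV Rk) (size_AV R'k) eqseq_cons => /and3P[/eqP LL _ /eqP->].
  by rewrite (inj_map (@addnI _) LL).
- move=> s; rewrite mem_AV; apply/idP/allpairsPdep.
    move=> /andP[avs sn]; have ns : n \in s.
      by rewrite (perm_mem sn) mem_iota /=.
    case/splitPr: ns avs sn => L R avs sn.
    have {}sn : perm_eq (L ++ R) (iota 0 n).
      rewrite -(perm_cons n) -(perm_cat2l [::]) /=.
      rewrite -cat1s perm_catCA cat1s; apply: perm_trans sn _.
      by rewrite -addn1 iotaD /= add0n perm_catC.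
    have LRn x : x \in L ++ R -> x < n by rewrite (perm_mem sn) mem_iota.
    move: avs; rewrite av132_cat; first last.
    + by apply/allP => x xR; apply: LRn; rewrite mem_cat xR orbT.
    + by apply/allP => x xL; apply: LRn; rewrite mem_cat xL.
    + by rewrite (perm_uniq sn) iota_uniq.
    move=> /and3P[avL avR LR]; have [pR pL] := perm_iota_cat sn LR.
    have sLR : size L + size R = n.
      by rewrite -size_cat (perm_size sn) size_iota.
    (* The letters of [L] fill an interval starting at [size R], so this subtraction never
       truncates. *)
    pose L' := [seq x - size R | x <- L].
    have LE : L = map (addn (size R)) L'.
      rewrite -map_comp -[LHS]map_id; apply/eq_in_map => x /=.
      by rewrite (perm_mem pL) mem_iota => /andP[/subnKC].
    exists (size L), (L', R); split.
    + by rewrite mem_iota; lia.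
    + apply/allpairsP; exists (L', R); split => //=; last first.
        by rewrite mem_AV avR -sLR addKn.
      rewrite mem_AV -(av132_shift (size R)) -LE avL /=.
      apply: (@perm_map_inj _ _ (addn (size R))); first exact: addnI.
      by rewrite -LE -iotaDl addn0.
    + by rewrite /glue /= -LE.
  move=> [k [_ [+ /allpairsP[[L R] [/= Lk Rk ->]] ->]]] /=.
  rewrite mem_iota /= ltnS => kn; have [Ln Rn LR] := glue_AV kn Lk Rk.
  have sR := size_AV Rk; move: Lk Rk; rewrite !mem_AV.
  move=> /andP[avL pL] /andP[avR pR].
  have pLR : perm_eq (map (addn (size R)) L ++ R) (iota 0 n).
    rewrite perm_catC -{1}(subnK kn) iotaD; apply: perm_cat => //.
    by rewrite add0n sR -{2}[n - k]addn0 iotaDl; apply: perm_map.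
  rewrite av132_cat ?(perm_uniq pLR) ?iota_uniq // av132_shift avL avR LR !andTb.
  rewrite /glue -cat1s perm_catCA cat1s -[0 :: _]/(iota 0 n.+1) -[n.+1]addn1 iotaD.
  rewrite perm_sym perm_catC /= perm_cons.
  by rewrite perm_sym.
Qed.

(** * From permutations to words *)

Lemma inc_sum r x s :
  inc r.+1 x s =
  \sum_(k < size s | x < nth 0 s k) inc r (nth 0 s k) (drop k.+1 s).
Proof.
elim: s => [|y s IH] /=; first by rewrite big_ord0.
by rewrite big_mkcond big_ord_recl IH /= drop0 [X in _ + X = _]big_mkcond.
Qed.

Lemma asc_sum r s :
  asc r s = \sum_(k < (size s).-1 | nth 0 s k < nth 0 s k.+1)
              inc r (nth 0 s k.+1) (drop k.+2 s).
Proof.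
elim: s => [|x [|y s] IH]; rewrite ?big_ord0 // [LHS]/=.
by rewrite big_mkcond big_ord_recl -/(asc r (y :: s)) IH /= drop0
  [X in _ + X = _]big_mkcond.
Qed.

Lemma card_tuple_cons (T : finType) r (P : pred (seq T)) :
  #|[pred t : r.+1.-tuple T | P t]| =
  \sum_x #|[pred t : r.-tuple T | P (x :: t)]|.
Proof.
rewrite -sum1_card; under [RHS]eq_bigr do rewrite -sum1_card.
rewrite pair_big_dep /=.
rewrite (reindex (fun q : T * r.-tuple T => [tuple of q.1 :: q.2])) //=.
exists (fun t : r.+1.-tuple T => (thead t, [tuple of behead t])).
  by move=> [x t] _ /=; rewrite theadE; congr (_, _); apply: val_inj.
by move=> t _; rewrite [in RHS](tuple_eta t); apply: val_inj.
Qed.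

Lemma card_pairs (T U : finType) (P : T -> pred U) :
  #|[pred t : T * U | P t.1 t.2]| = \sum_x #|P x|.
Proof.
rewrite -sum1_card; under [RHS]eq_bigr do rewrite -sum1_card.
by rewrite pair_big_dep.
Qed.

Section Words.
Variables (n : nat) (f : 'I_n -> nat).

Definition fword := [seq f i | i <- enum 'I_n].

Lemma size_fword : size fword = n.
Proof. by rewrite size_map size_enum_ord. Qed.

Lemma nth_fword (i : 'I_n) : nth 0 fword i = f i.
Proof. by rewrite (nth_map i) ?size_enum_ord // nth_ord_enum. Qed.

(** Paths of this relation merge the two sortedness conditions in [occ], on positions and on values,
    into one. *)
Definition flt : rel 'I_n := fun i j => (i < j) && (f i < f j).

Lemma path_flt i js :
  path flt i js = path ltn (val i) (map val js) && path ltn (f i) (map f js).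
Proof. by elim: js i => //= j js IH i; rewrite IH andbACA. Qed.

Definition nfpath r i := #|[pred js : r.-tuple 'I_n | path flt i js]|.

Lemma nfpathS r i : nfpath r.+1 i = \sum_(j | flt i j) nfpath r j.
Proof.
rewrite /nfpath (card_tuple_cons _ (path flt i)) [RHS]big_mkcond.
apply: eq_bigr => j _ /=; case: (flt i j) => //=.
by apply: eq_card0.
Qed.

(** Both sides satisfy the same recursion on [r]: choose the first position of the chain, then
    continue from it. *)
Lemma inc_fword r (i : 'I_n) : inc r (f i) (drop i.+1 fword) = nfpath r i.
Proof.
elim: r i => [|r IH] i.
  rewrite inc0 /nfpath (@fintype.eq_card1 _ [tuple]) // => t.
  by rewrite !inE tuple0 /= eqxx.
rewrite inc_sum nfpathS size_drop size_fword.
pose G j := inc r (nth 0 fword j) (drop j.+1 fword).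
transitivity (\sum_(i.+1 <= j < n | f i < nth 0 fword j) G j).
  rewrite -[i.+1]add0n big_addn big_mkord add0n.
  apply: eq_big => k; rewrite nth_drop addnC // => _.
  by rewrite drop_drop /G addSn.
rewrite big_geq_mkord; apply: eq_big => j; rewrite nth_fword.
  by rewrite andbC.
by move=> _; rewrite -IH /G nth_fword.
Qed.

(** The inner sum encodes the position after [i]; it is empty when [i] is the last position. *)
Lemma asc_fword r :
  asc r fword =
  \sum_(i : 'I_n) \sum_(j : 'I_n | j == i.+1 :> nat) (f i < f j) * nfpath r j.
Proof.
rewrite asc_sum size_fword; case: n f nfpath fword nth_fword inc_fword.
  by move=> *; rewrite !big_ord0.
move=> n' f' nf w nthw incw; rewrite [RHS]big_ord_recr /= big_mkcond.
rewrite [X in _ = _ + X]big1 ?addn0; last first.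
  by move=> j /eqP jn; have := ltn_ord j; rewrite jn ltnn.
apply: eq_bigr => k _; rewrite (big_pred1 (lift ord0 k)); last first.
  by move=> j; rewrite /= -val_eqE.
rewrite -incw -!nthw /= /bump add1n.
by case: ifP => _; rewrite ?mul1n ?mul0n.
Qed.

End Words.

Definition word n (p : 'S_n) := fword (fun i => val (p i)).

Lemma size_word n (p : 'S_n) : size (word p) = n.
Proof. exact: size_fword. Qed.

Lemma nth_word n (p : 'S_n) (i : 'I_n) : nth 0 (word p) i = p i.
Proof. exact: nth_fword. Qed.

Lemma exists_succ n (i : 'I_n) (Q : pred 'I_n) :
  [exists j : 'I_n, (j == i.+1 :> nat) && Q j] =
  \sum_(j : 'I_n | j == i.+1 :> nat) Q j :> nat.
Proof.
case: (ltnP i.+1 n) => [lt_in|le_ni].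
  rewrite (big_pred1 (Ordinal lt_in)); last by move=> j; rewrite /= -val_eqE.
  congr nat_of_bool; apply/existsP/idP => [[j /andP[/eqP ji]]|Qi].
    by rewrite (_ : j = Ordinal lt_in) //; apply: val_inj.
  by exists (Ordinal lt_in); rewrite eqxx.
have nj (j : 'I_n) : (j == i.+1 :> nat) = false.
  by apply/eqP => ji; have := ltn_ord j; rewrite ji ltnNge le_ni.
rewrite big_pred0 //; apply/eqP; rewrite eqb0; apply/existsPn => j.
by rewrite nj.
Qed.

Lemma occ_word n (p : 'S_n) r : occ p r.+2 = asc r (word p).
Proof.
rewrite asc_fword; case: r => [|r] /=.
  rewrite -sum1_card big_mkcond; apply: eq_bigr => i _; rewrite inE.
  transitivity (nat_of_bool
    [exists i' : 'I_n, (i' == i.+1 :> nat) && (p i < p i')]).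
    by case: [exists _, _].
  rewrite exists_succ; apply: eq_bigr => j _.
  by rewrite -inc_fword inc0 muln1.
(* Once [j] is the successor of [i], this says that [i], [j], [js] form an occurrence. *)
pose Q i (js : seq 'I_n) (j : 'I_n) := (val (p i) < val (p j)) &&
  path (flt (fun i => val (p i))) j js.
pose P (i : 'I_n) (js : r.+1.-tuple 'I_n) :=
  [exists j : 'I_n, (j == i.+1 :> nat) && Q i js j].
transitivity #|[pred t : 'I_n * r.+1.-tuple 'I_n | P t.1 t.2]|.
  apply: eq_card => -[i js]; rewrite !inE; apply: eq_existsb => j /=.
  by case: eqP => // ji /=; rewrite /Q path_flt -ji andbCA.
rewrite card_pairs; apply: eq_bigr => i _; rewrite -sum1_card big_mkcond.
under [RHS]eq_bigr do rewrite /nfpath -sum1_card big_mkcond big_distrr.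
(* With the tuple fixed outside, the sum over the successor [j] is again the existential of [P]. *)
rewrite exchange_big; apply: eq_bigr => js _ /=.
transitivity (nat_of_bool (P i js)).
  by rewrite -[_ \in _]/(P i js); case: ifP.
rewrite exists_succ; apply: eq_bigr => j _; rewrite inE /Q.
by case: (_ < _); case: (path _ _ _).
Qed.

Lemma av132P s :
  reflect (forall a b c, a < b < c -> c < size s ->
             ~~ (nth 0 s a < nth 0 s c < nth 0 s b)) (av132 s).
Proof.
apply: (iffP idP).
  elim: s => //= x s IH /andP[/(pairwiseP 0) xs /IH {}IH] [|a] [|b] [|c];
    rewrite ?ltn0 ?andbF //=.
    by rewrite !ltnS => bc cs; apply: xs => //; rewrite inE; lia.
  by rewrite !ltnS; exact: IH.
elim: s => //= x s IH H; apply/andP; split.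
  apply/(pairwiseP 0) => b c bs cs bc.
  by have := H 0 b.+1 c.+1; apply.
by apply: IH => a b c abc cs; have := H a.+1 b.+1 c.+1; apply.
Qed.

Lemma avoids132_word n (p : 'S_n) : avoids132 p <-> av132 (word p).
Proof.
split=> [av|/av132P av].
  apply/av132P => a b c abc; rewrite size_word => cn.
  have bn : b < n by lia.
  have an : a < n by lia.
  apply/negP => H; apply: av; exists (Ordinal an), (Ordinal bn), (Ordinal cn).
  by split=> //; rewrite -!nth_word.
move=> [a [b [c [abc pabc]]]]; have := av a b c abc.
by rewrite size_word !nth_word pabc => /(_ (ltn_ord c)).
Qed.

Lemma word_inj n : injective (@word n).
Proof.
move=> p q pq; apply/permP => i; apply: val_inj.
by rewrite /= -!nth_word pq.
Qed.

Lemma perm_word n (p : 'S_n) : perm_eq (word p) (iota 0 n).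
Proof.
have uw : uniq (word p).
  by rewrite map_inj_uniq ?enum_uniq // => i j /val_inj /perm_inj.
apply: uniq_perm; rewrite ?iota_uniq //.
apply: (uniq_min_size uw _ _).2; last by rewrite size_word size_iota.
by move=> _ /mapP[i _ ->]; rewrite mem_iota /=.
Qed.

Lemma word_surj n s : perm_eq s (iota 0 n) -> exists p : 'S_n, word p = s.
Proof.
move=> sn; have ss : size s = n by rewrite (perm_size sn) size_iota.
have us : uniq s by rewrite (perm_uniq sn) iota_uniq.
have lt_s (i : 'I_n) : nth 0 s i < n.
  have : nth 0 s i \in s by rewrite mem_nth ?ss.
  by rewrite (perm_mem sn) mem_iota.
have injs : injective (fun i : 'I_n => Ordinal (lt_s i)).
  move=> i j [] /eqP; rewrite nth_uniq ?ss // => /eqP; exact: val_inj.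
exists (perm injs); apply: (@eq_from_nth _ 0); rewrite size_word // => i lt_in.
by rewrite -[i]/(val (Ordinal lt_in)) nth_word permE.
Qed.

Lemma perm_AV_word n :
  perm_eq [seq word p | p <- enum 'S_n & `[< avoids132 p >]] (AV n).
Proof.
apply: uniq_perm.
- by rewrite (map_inj_uniq (@word_inj n)) filter_uniq ?enum_uniq.
- exact/filter_uniq/permutations_uniq.
move=> s; rewrite mem_AV; apply/mapP/andP.
  move=> [p]; rewrite mem_filter => /andP[/asboolP/avoids132_word av _ ->].
  by rewrite av perm_word.
move=> [avs /word_surj[p ps]]; exists p => //; rewrite mem_filter mem_enum andbT.
by apply/asboolP/avoids132_word; rewrite ps.
Qed.

Local Open Scope ring_scope.

(** * Filtration and grading by one indeterminate *)

Section Filtration.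
Variables (I : choiceType) (R : comNzRingType) (i : I).
Local Notation M := {cmonom I}.
Local Notation S := (fps I R).
Implicit Types (f g h c : S) (m : M) (u v : nat -> S).

Lemma fcoefD f g m : fcoef (f + g) m = fcoef f m + fcoef g m.
Proof. by []. Qed.

Lemma fcoefN f m : fcoef (- f) m = - fcoef f m.
Proof. by []. Qed.

Lemma fcoef1 m : fcoef (1 : S) m = (m == mone)%:R.
Proof. by []. Qed.

Lemma fcoefM f g m :
  fcoef (f * g) m =
  \sum_(p <- fset_set (factors2 m)) fcoef f p.1 * fcoef g p.2.
Proof. by rewrite /= fsbig_finite //; exact: factors2_finite. Qed.

Lemma fcoef_sum (J : Type) (r : seq J) (P : pred J) (F : J -> S) m :
  fcoef (\sum_(j <- r | P j) F j) m = \sum_(j <- r | P j) fcoef (F j) m.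
Proof. by elim/big_rec2: _ => // j y1 y2 _ <-. Qed.

Lemma in_factors2 m p :
  (p \in fset_set (factors2 m)) = (mmul p.1 p.2 == m).
Proof.
rewrite in_fset_set; last exact: factors2_finite.
by apply/idP/eqP => [/set_mem|/mem_set].
Qed.

(** Divisibility by the [N]-th power of the indeterminate [i], read on coefficients. *)
Definition fps_ge N f : Prop := forall m, (m i < N)%N -> fcoef f m = 0.

Lemma fps_geD N f g : fps_ge N f -> fps_ge N g -> fps_ge N (f + g).
Proof. by move=> hf hg m mN; rewrite fcoefD hf // hg // addr0. Qed.

Lemma fps_geN N f : fps_ge N f -> fps_ge N (- f).
Proof. by move=> hf m mN; rewrite fcoefN hf // oppr0. Qed.

Lemma fps_geM N K f g : fps_ge N f -> fps_ge K g -> fps_ge (N + K)%N (f * g).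
Proof.
move=> hf hg m mNK; rewrite fcoefM big1_seq // => p /andP[_].
rewrite in_factors2 => /eqP pm; move: mNK; rewrite -pm cmM => mNK.
case: (ltnP (p.1 i) N) => [/hf->|pN]; first by rewrite mul0r.
by rewrite (hg p.2) ?mulr0 //; lia.
Qed.

Lemma fps_geMl N f g : fps_ge N f -> fps_ge N (f * g).
Proof. by move=> hf; rewrite -[N]addn0; apply: fps_geM. Qed.

Lemma fps_geX N f : fps_ge 1%N f -> fps_ge N (f ^+ N).
Proof.
by move=> hf; elim: N => // N IH; rewrite exprS -add1n; apply: fps_geM.
Qed.

Lemma fps_ge_eq0 f : (forall N, fps_ge N f) -> f = 0.
Proof. by move=> hf; apply: fpsP => m; rewrite (hf (m i).+1). Qed.

(** The inverse is the geometric series. As [f ^+ k] has order at least [k], the coefficient at [m]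
    is settled by the first [m i + 1] terms. *)
Lemma fps_ge_unit f : fps_ge 1%N f -> 1 - f \is a GRing.unit.
Proof.
move=> hf; pose T N := \sum_(k < N) f ^+ k.
have TB N K m : (m i < N)%N -> fcoef (T (N + K)%N) m = fcoef (T N) m.
  move=> mN; elim: K => [|K IH]; first by rewrite addn0.
  rewrite addnS /T big_ord_recr fcoefD -/(T _) IH (@fps_geX (N + K)) ?addr0 //.
  by lia.
pose G : S := Fps (fun m => fcoef (T (m i).+1) m).
have GT N : fps_ge N (G - T N).
  move=> m mN; rewrite fcoefD fcoefN /=.
  by rewrite -{1}(subnKC mN) TB // subrr.
have GE : G * (1 - f) = 1.
  apply/eqP; rewrite -subr_eq0; apply/eqP/fps_ge_eq0 => N.
  have -> : G * (1 - f) - 1 = (G - T N) * (1 - f) - f ^+ N.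
    have TE : T N * (1 - f) = 1 - f ^+ N.
      by rewrite mulrC -opprB mulNr -subrX1 opprB.
    by rewrite [in RHS]mulrBl TE opprB addrA addrAC addrK.
  by apply: fps_geD; [exact: fps_geMl | apply/fps_geN/fps_geX].
by apply/unitrPr; exists G; rewrite mulrC.
Qed.

(** Homogeneity in the indeterminate [i] alone; the other exponents are free. *)
Definition fps_hom d f : Prop := forall m, m i != d -> fcoef f m = 0.

Lemma fps_hom1 : fps_hom 0%N 1.
Proof. by move=> m; rewrite fcoef1; case: (m =P _) => // ->; rewrite cm1. Qed.

Lemma fps_homX j : fps_hom (i == j) (fpsX R j).
Proof.
move=> m; rewrite /fpsX /=; case: (m =P _) => // ->.
by rewrite cmU eq_sym [j == i]eq_sym; case: (i == j).
Qed.

Lemma fps_homM d e f g : fps_hom d f -> fps_hom e g ->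
  fps_hom (d + e)%N (f * g).
Proof.
move=> hf hg m mde; rewrite fcoefM big1_seq // => p /andP[_].
rewrite in_factors2 => /eqP pm; move: mde; rewrite -pm cmM => mde.
case: (eqVneq (p.1 i) d) => [pd|/hf->]; last by rewrite mul0r.
by rewrite (hg p.2) ?mulr0 //; apply: contraNneq mde => ->; rewrite pd.
Qed.

Lemma fps_homXn d f n : fps_hom d f -> fps_hom (d * n)%N (f ^+ n).
Proof.
move=> hf; elim: n => [|n IH]; first by rewrite muln0; exact: fps_hom1.
by rewrite exprS mulnS; exact: fps_homM.
Qed.

Lemma fps_hom0_prod (J : Type) (r : seq J) (P : pred J) (F : J -> S) :
  (forall j, P j -> fps_hom 0%N (F j)) -> fps_hom 0%N (\prod_(j <- r | P j) F j).
Proof.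
move=> hF; elim/big_rec: _ => [|j f Pj hf]; first exact: fps_hom1.
by rewrite -[0%N]addn0; apply: fps_homM => //; exact: hF.
Qed.

Lemma fps_hom_sum d (J : Type) (r : seq J) (P : pred J) (F : J -> S) :
  (forall j, P j -> fps_hom d (F j)) -> fps_hom d (\sum_(j <- r | P j) F j).
Proof.
move=> hF; elim/big_rec: _ => [|j f Pj hf m md] //.
by rewrite fcoefD hf // hF // addr0.
Qed.

(** The infinite sum of the [u n], provided each [u n] is homogeneous of degree [n]: only [u (m i)]
    can then contribute at [m]. *)
Definition fps_series u : S := Fps (fun m => fcoef (u (m i)) m).

Lemma eq_fps_series u v : u =1 v -> fps_series u = fps_series v.
Proof. by move=> uv; apply: fpsP => m /=; rewrite uv. Qed.

Lemma fps_seriesD u v :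
  fps_series u + fps_series v = fps_series (fun n => u n + v n).
Proof. exact: fpsP. Qed.

Lemma fps_series_hom d c :
  fps_hom d c -> c = fps_series (fun n => if n == d then c else 0).
Proof. by move=> hc; apply: fpsP => m /=; case: eqVneq => // /hc ->. Qed.

Lemma fps_seriesM u v :
  (forall n, fps_hom n (u n)) -> (forall n, fps_hom n (v n)) ->
  fps_series u * fps_series v =
  fps_series (fun n => \sum_(k < n.+1) u k * v (n - k)%N).
Proof.
move=> hu hv; apply: fpsP => m; rewrite fcoefM /= fcoef_sum.
under [RHS]eq_bigr do rewrite fcoefM.
rewrite exchange_big /=; apply: eq_big_seq => p; rewrite in_factors2 => /eqP pm.
have mE : m i = (p.1 i + p.2 i)%N by rewrite -pm cmM.
have km : (p.1 i < (m i).+1)%N by rewrite mE ltnS leq_addr.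
have pE : (m i - p.1 i)%N = p.2 i by rewrite mE addKn.
(* For a given factorization of [m], only the index [k = p.1 i] of the Cauchy product survives. *)
rewrite (bigD1 (Ordinal km)) //= pE big1 ?addr0 // => k /eqP kp.
rewrite (hu k) ?mul0r //; apply/eqP => pk; apply: kp; exact: val_inj.
Qed.

Lemma fps_hom_seriesM d c u : fps_hom d c ->
  c * fps_series u =
  fps_series (fun n => if (d <= n)%N then c * u (n - d)%N else 0).
Proof.
move=> hc; apply: fpsP => m; rewrite fcoefM /=.
have E p : p \in fset_set (factors2 m) -> m i = (p.1 i + p.2 i)%N.
  by rewrite in_factors2 => /eqP <-; rewrite cmM.
case: ifP => dm; rewrite ?fcoefM; last first.
  rewrite big1_seq //= => p /E mE; rewrite hc ?mul0r //.
  by apply: contraFneq dm => <-; rewrite mE leq_addr.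
apply: eq_big_seq => p /E mE; case: (eqVneq (p.1 i) d) => [pd|/hc->].
  by rewrite mE pd addKn.
by rewrite !mul0r.
Qed.

End Filtration.

(** * The generating functions *)

(** Pascal's rule in the exponents. *)
Lemma prod_binS (R : comNzRingType) (x : nat -> R) m :
  \prod_(k < m.+2) x k ^+ 'C(m.+1, k) =
  \prod_(k < m.+1) x k ^+ 'C(m, k) * \prod_(k < m.+1) x k.+1 ^+ 'C(m, k).
Proof.
rewrite big_ord_recl [x _ ^+ _]expr1.
under eq_bigr do rewrite lift0 binS exprD.
rewrite big_split mulrA; congr (_ * _) => /=.
transitivity (\prod_(k < m.+2) x k ^+ 'C(m, k)).
  by rewrite [RHS]big_ord_recl bin0 expr1.
by rewrite big_ord_recr /= bin_small // expr0 mulr1.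
Qed.

Section Weight.
Variables (A : comNzRingType) (x : nat -> A).

(* A larger letter put on the right of a word keeps each occurrence of         *)
(* 12-3-...-k and extends it to one of 12-3-...-(k+1), i.e. it substitutes     *)
(* x_k x_(k+1) for x_k; ymon m r is the outcome of m such steps on x_(r+2).    *)
Definition ymon (m r : nat) : A :=
  \prod_(k < m.+1) x (r + k).+2 ^+ 'C(m, k).

Lemma ymonS m r : ymon m.+1 r = ymon m r * ymon m r.+1.
Proof.
rewrite /ymon (prod_binS (fun k => x (r + k).+2)); congr (_ * _).
by apply: eq_bigr => k _; rewrite addSnnS.
Qed.

(** The weight after [m] substitutions, which leave [x 1] alone. Stopping at [size s] loses nothing,
    by [asc_gt]. *)
Definition wt (m : nat) (s : seq nat) : A :=
  x 1 ^+ size s * \prod_(r < size s) ymon m r ^+ asc r s.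

Lemma wt_widen m s N : (size s <= N)%N ->
  wt m s = x 1 ^+ size s * \prod_(r < N) ymon m r ^+ asc r s.
Proof.
move=> sN; congr (_ * _).
rewrite (big_ord_widen N (fun r => ymon m r ^+ asc r s)) //.
rewrite [RHS](bigID (fun r : 'I_N => r < size s)%N) /= [X in _ * X]big1 ?mulr1 //.
by move=> r; rewrite -leqNgt => sr; rewrite asc_gt ?expr0 // ltnW.
Qed.

Lemma wt_shift c m s : wt m (map (addn c) s) = wt m s.
Proof.
by rewrite /wt size_map; congr (_ * _); apply: eq_bigr => r _; rewrite asc_shift.
Qed.

(** By [asc_cat] each occurrence in [L] counts once at [r] and once at [r.+1], and [ymonS] merges
    the two factors into [ymon m.+1 r]. The ascent into [n] gives the extra [ymon m 0]. *)
Lemma wt_cat m n L R : all (gtn n) L -> all (gtn n) R -> allrel gtn L R ->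
  wt m (L ++ n :: R) =
  x 1 * ((if L is [::] then 1 else ymon m 0) * wt m.+1 L) * wt m R.
Proof.
move=> Ln Rn LR; pose N := (size L + size R)%N.
rewrite (@wt_widen m (_ ++ _) N.+1); last by rewrite size_cat /= addnS.
rewrite (@wt_widen m R N.+1); last by rewrite /N; lia.
rewrite (@wt_widen m.+1 L N); last by rewrite /N; lia.
under eq_bigr do rewrite asc_cat // 2!exprD.
rewrite !big_split /= big_ord_recr /= (@asc_gt N L) ?expr0 ?mulr1; last first.
  by rewrite /N; lia.
rewrite [X in _ * X * _]big_ord_recl /=.
rewrite (_ : ymon m 0 ^+ _ = if L is [::] then 1 else ymon m 0);
  last by case: L {Ln LR N}.
under [X in _ = _ * (_ * (_ * X)) * _]eq_bigr do rewrite ymonS exprMn.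
rewrite big_split /= size_cat /= addnS exprS exprD.
set c := if L is [::] then _ else _.
set a := \prod_(r < N) ymon m r ^+ asc r L.
set b := \prod_(r < N) ymon m _ ^+ asc _ L.
set d := \prod_(r < N.+1) _.
by ring.
Qed.

Lemma wt_glue m n k L R : (k <= n)%N -> L \in AV k -> R \in AV (n - k)%N ->
  wt m (glue n L R) =
  x 1 * ((if k is 0%N then 1 else ymon m 0) * (wt m.+1 L * wt m R)).
Proof.
move=> kn Lk Rk; have [Ln Rn LR] := glue_AV kn Lk Rk.
rewrite /glue wt_cat // wt_shift -!mulrA -(size_AV Lk).
by case: {Lk Ln LR} L.
Qed.

End Weight.

(** Degrees are taken in x_1, the indeterminate of index 0, so they record the length of a word. *)
Local Notation hom := (@fps_hom nat int 0%N).

Lemma xvar1_hom : hom 1%N (xvar 1).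
Proof. exact: (@fps_homX nat int 0%N 0%N). Qed.

Lemma xvarSS_hom k : hom 0%N (xvar k.+2).
Proof. exact: (@fps_homX nat int 0%N k.+1). Qed.

Lemma ymon_hom m r : hom 0%N (ymon xvar m r).
Proof.
apply: fps_hom0_prod => k _; apply: (@fps_homXn nat int 0%N 0%N).
exact: xvarSS_hom.
Qed.

Lemma wt_hom m s : hom (size s) (wt xvar m s).
Proof.
rewrite -[size s]addn0; apply: fps_homM.
  by rewrite -[X in hom X]mul1n; apply: fps_homXn; exact: xvar1_hom.
apply: fps_hom0_prod => r _; apply: (@fps_homXn nat int 0%N 0%N).
exact: ymon_hom.
Qed.

Definition avsum m n : fps nat int := \sum_(s <- AV n) wt xvar m s.

Lemma avsum_hom m n : hom n (avsum m n).
Proof.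
rewrite /avsum big_seq; apply: fps_hom_sum => s /size_AV <-; exact: wt_hom.
Qed.

Lemma AV0 : AV 0 = [:: [::]].
Proof. by []. Qed.

Lemma avsum0 m : avsum m 0 = 1.
Proof. by rewrite /avsum AV0 big_seq1 /wt /= big_ord0 mulr1. Qed.

(** The degree [k] part of 1 + P_m (F_(m+1) - 1), the contribution of the left factor. *)
Definition avsumL m k := (if k is 0%N then 1 else ymon xvar m 0%N) * avsum m.+1 k.

Lemma avsumS m n :
  avsum m n.+1 = xvar 1 * \sum_(k < n.+1) avsumL m k * avsum m (n - k)%N.
Proof.
rewrite /avsum (perm_big _ (AV_rec n)) big_allpairs_dep.
rewrite mulr_sumr -(big_mkord xpredT
  (fun k => xvar 1 * (avsumL m k * avsum m (n - k)%N))).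
rewrite /index_iota subn0; apply: eq_big_seq => k; rewrite mem_iota /= ltnS => kn.
rewrite big_allpairs_dep /= /avsumL /avsum -!mulrA big_distrlr /= !mulr_sumr.
apply: eq_big_seq => L Lk; rewrite !mulr_sumr; apply: eq_big_seq => R Rk.
exact: wt_glue.
Qed.

Definition avser m : fps nat int := fps_series 0%N (avsum m).

Lemma avser_rec m :
  avser m * (1 - xvar 1 + xvar 1 * Pmon m - xvar 1 * Pmon m * avser m.+1) = 1.
Proof.
rewrite -[Pmon m]/(ymon xvar m 0%N).
pose D := fps_series 0%N (avsumL m).
have DE : D = 1 - ymon xvar m 0%N + ymon xvar m 0%N * avser m.+1.
  rewrite (fps_hom_seriesM _ (@ymon_hom m 0%N)).
  rewrite [1 - _](@fps_series_hom _ _ 0%N 0%N); last first.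
    move=> mm md; rewrite fcoefD fcoefN ymon_hom //.
    by rewrite (@fps_hom1 _ _ 0%N mm md) subr0.
  rewrite fps_seriesD; apply: eq_fps_series => -[|k]; rewrite /avsumL /= ?subn0.
    by rewrite avsum0 !mulr1 subrK.
  by rewrite add0r.
have hD k : hom k (avsumL m k).
  rewrite -[X in hom X]add0n; apply: fps_homM; last exact: avsum_hom.
  case: k => [|k]; [exact: fps_hom1 | exact: ymon_hom].
(* This is [avsumS] collected over all degrees, with the empty word giving the 1. *)
have E : avser m = 1 + xvar 1 * (D * avser m).
  rewrite fps_seriesM //; last exact: avsum_hom.
  rewrite (@fps_hom_seriesM _ _ 0%N 1%N); last exact: xvar1_hom.
  rewrite [X in _ = X + _](fps_series_hom (@fps_hom1 nat int 0%N)).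
  rewrite fps_seriesD; apply: eq_fps_series => -[|n] /=.
    by rewrite avsum0 addr0.
  by rewrite add0r avsumS subn1.
move: E; rewrite DE; move: (xvar 1) (ymon _ _ _) (avser m) (avser m.+1).
(* Writing 1 as 1 + y - y lets [E] turn 1 + y into [f], after which the goal is a ring identity. *)
move=> a b f g E; rewrite -[RHS](addrK (a * ((1 - b + b * g) * f))) -E.
by ring.
Qed.

(** The error of a truncation at level [j] is the error at level [j.+1] times a multiple of [a j],
    so each level with [j > 0] raises its order in [i] by one. *)
Lemma is_cfrac_rec (I : choiceType) (R : comNzRingType) (i : I)
    (a b F : nat -> fps I R) :
  (forall j, fps_ge i 1%N (a j.+1)) -> (forall j, fps_ge i 1%N (1 - b j)) ->
  (forall j, F j * (b j - a j.+1 * F j.+1) = 1) ->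
  is_cfrac a b (a 0%N * F 0%N).
Proof.
move=> a_ge b_ge FE.
have unitK n j : b j - cfrac_from a b n j.+1 \is a GRing.unit.
  have K_ge : fps_ge i 1%N (cfrac_from a b n j.+1).
    by case: n => [|n] //=; apply: fps_geMl.
  move: (cfrac_from _ _ _ _) (b j) K_ge (b_ge j) => t z t_ge z_ge.
  have -> : z - t = 1 - ((1 - z) + t) by ring.
  by apply: (@fps_ge_unit _ _ i); apply: fps_geD.
have step n j : cfrac_from a b n.+1 j - a j * F j =
    (cfrac_from a b n j.+1 - a j.+1 * F j.+1) *
      (a j * F j / (b j - cfrac_from a b n j.+1)).
  apply: (mulIr (unitK n j)); rewrite -mulrA divrK // mulrBl /= divrK //.
  move: (FE j).
  move: (a j) (F j) (b j) (cfrac_from _ _ _ _) (a j.+1 * _) => x y z t u E.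
  (* The bare numerator is multiplied by 1 in the form given by the relation for [F j]. *)
  by rewrite -{1}[x]mulr1 -E; ring.
have cfrac_ge n j : fps_ge i n (cfrac_from a b n j.+1 - a j.+1 * F j.+1).
  elim: n j => [|n IH] j //; rewrite step -mulrA -addn1.
  by apply: fps_geM => //; apply: fps_geMl.
(* The outermost level gains no order, as [a 0] is arbitrary: truncation [n.+1] is correct below
   order [n], hence the bound [m i + 2]. *)
split=> // m; exists (m i).+2 => -[//|n] mn; apply/eqP; rewrite -subr_eq0.
apply/eqP; rewrite -fcoefN -fcoefD step.
by apply: (fps_geMl _ (cfrac_ge n 0%N)).
Qed.

(** * Back to the sum over permutations *)

Lemma wt0E (A : comNzRingType) (x : nat -> A) s :
  wt x 0 s = \prod_(1 <= k < (size s).+1)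
               x k ^+ (if k is r.+2 then asc r s else size s).
Proof.
rewrite /wt; case E: (size s) => [|n]; first by rewrite big_geq // big_ord0 mulr1.
(* The last factor on the left belongs to k = [size s + 1] and is 1, by [asc_gt]. *)
rewrite big_ltn // big_ord_recr /= asc_gt ?E // expr0 mulr1 !big_add1 big_mkord.
congr (_ * _).
by apply: eq_bigr => r _; rewrite /ymon big_ord1 bin0 expr1 addn0.
Qed.

Lemma weight_word n (p : 'S_n) : weight (existT _ n p) = wt xvar 0 (word p).
Proof.
rewrite wt0E size_word; apply: eq_big_nat => -[|[|k]] //= _.
by rewrite -occ_word.
Qed.

Lemma fcoef_weight_neq0 (s : {n : nat & 'S_n}) m :
  fcoef (weight s) m != 0 -> tag s = m 0%N.
Proof.
case: s => n p /=; rewrite weight_word => cm; apply/esym/eqP.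
by apply: contraNT cm => mn; rewrite (@wt_hom 0 (word p)) ?size_word.
Qed.

Lemma finite_tag n : finite_set [set s : {n : nat & 'S_n} | tag s = n]%classic.
Proof.
have -> : ([set s : {n : nat & 'S_n} | tag s = n] =
    [set existT (fun n => 'S_n) n p | p in setT])%classic.
  apply/seteqP; split=> [[k p] /= kn|_ [p _ <-] //].
  by move: p; rewrite kn => p; exists p.
exact/finite_image/finite_finset.
Qed.

Lemma weight_summable : fps_summable S132 weight.
Proof.
move=> m; apply: (sub_finite_set _ (finite_tag (m 0%N))) => s [_].
exact: fcoef_weight_neq0.
Qed.

Lemma fps_sum_weight : fps_sum S132 weight = avser 0.
Proof.
apply: fpsP => m /=; rewrite /avsum fcoef_sum; set n := m 0%N.
rewrite -(perm_big _ (perm_AV_word n)) big_map /=.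
pose r := [seq existT (fun n => 'S_n) n p | p <- enum 'S_n & `[< avoids132 p >]].
transitivity (\sum_(s <- r) fcoef (weight s) m); last first.
  by rewrite big_map; apply: eq_bigr => p _; rewrite weight_word.
have ur : uniq r.
  rewrite map_inj_uniq; first exact/filter_uniq/enum_uniq.
  by move=> p q /eqP; rewrite eq_Tagged => /eqP.
(* Extending the sum from length [n] to all of [S132] adds only zero coefficients, by
   [fcoef_weight_neq0]. *)
rewrite (fsbig_seq _ _ ur); apply/esym/fsbig_widen.
  by move=> _ /mapP[p + ->]; rewrite mem_filter => /andP[/asboolP].
move=> [k p] [/= av nr]; apply: contrapT => /eqP /fcoef_weight_neq0 /= kn.
apply: nr; move: p av; rewrite kn => p av; apply/mapP; exists p => //.
by rewrite mem_filter mem_enum andbT; apply/asboolP.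
Qed.

Theorem theorem2p2 :
  fps_summable S132 weight /\
  is_cfrac (fun n => if n is m.+1 then xvar 1 * Pmon m else 1)
           (fun n => 1 - xvar 1 + xvar 1 * Pmon n)
           (fps_sum S132 weight).
Proof.
split; first exact: weight_summable.
have x_ge : fps_ge 0%N 1%N (xvar 1).
  by move=> m m0; apply: xvar1_hom; apply: contraTneq m0 => ->.
(* The factor 1 supplies the leading numerator [a 0]. *)
rewrite fps_sum_weight -[avser 0]mul1r.
apply: (@is_cfrac_rec _ _ 0%N _ _ avser) => j.
- exact: fps_geMl.
- rewrite opprD addrA subKr; apply: fps_geD => //.
  exact/fps_geN/fps_geMl.
- exact: avser_rec.
Qed.
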